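(* Let $n\ge 1$, let $0<\alpha<1$ and $\lambda>0$, and let $\beta_1,\dots,\beta_n>0$ and $\beta_1^*,\dots,\beta_n^*>0$. Let $X_1,\dots,X_n$ be independent random variables with $X_i\sim \mathrm{ENH}(\alpha,\lambda,\beta_i)$, and let $X_1^*,\dots,X_n^*$ be another set of independent random variables with $X_i^*\sim \mathrm{ENH}(\alpha,\lambda,\beta_i^* )$, $i=1,\dots,n$. Write $X_{n:n}=\max_i X_i$ and $X^*_{n:n}=\max_i X_i^*$. If $\sum_{i=1}^n\beta_i^*\le\sum_{i=1}^n\beta_i<1$, then $X_{n:n}\ge_{\mathrm{disp}}X^*_{n:n}$.
   Context: For $\alpha,\lambda,\beta>0$, $X\sim \mathrm{ENH}(\alpha,\lambda,\beta)$ (exponentiated Nadarajah-Haghighi distribution) means that $X$ is a positive random variable with distribution function $[1-\exp\{1-(1+\lambda x)^{\alpha}\}]^{\beta}$ for $x>0$ (and $0$ for $x\le 0$). Dispersive order: for non-negative random variables $X,Y$ with distribution functions $F,G$ and right continuous inverses $F^{-1},G^{-1}$ (where $h^{-1}(u)=\sup\{x\in\mathbb{R}:h(x)\le u\}$ for an increasing function $h$), $X\le_{\mathrm{disp}}Y$ (equivalently $Y\ge_{\mathrm{disp}}X$) means $F^{-1}(v)-F^{-1}(u)\le G^{-1}(v)-G^{-1}(u)$ for all $0<u\le v<1$. *)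

(* Defs.v *)
From HB Require Import structures.
From mathcomp Require Import all_boot all_order all_algebra.
From mathcomp Require Import all_classical all_reals all_analysis.
From mathcomp Require Import measurable_realfun.

Set Implicit Arguments.
Unset Strict Implicit.
Unset Printing Implicit Defensive.

Import Order.TTheory GRing.Theory Num.Theory.

Local Open Scope classical_set_scope.
Local Open Scope ring_scope.

Definition mutually_independent d (T : measurableType d) (R : realType)
    (P : probability T R) (I : finType) (X : I -> {RV P >-> R}) : Prop :=
  forall (J : {set I}) (A : I -> set R), (forall i, measurable (A i)) ->
    P (\bigcap_(i in [set` J]) (X i @^-1` A i))
    = (\prod_(i in J) P (X i @^-1` A i))%E.

(* The value of the cdf at 0 gives P (X <= 0) = 0, so positivity of X (which is
   only meaningful almost surely) is part of this definition. *)
Definition is_ENH d (T : measurableType d) (R : realType)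
    (P : probability T R) (X : {RV P >-> R}) (alpha lambda beta : R) : Prop :=
  forall x : R, cdf X x =
    (if 0 < x
     then (1 - expR (1 - (1 + lambda * x) `^ alpha)) `^ beta
     else 0)%:E.

Section max_RV.
Context d (T : measurableType d) (R : realType) (P : probability T R) (n : nat).
Variable X : 'I_n.+1 -> {RV P >-> R}.

(* Starting from [X ord0 w] instead of a constant makes this the exact maximum
   of the [X i w], whatever their signs. *)
Definition max_RV : T -> R := fun w => \big[Num.max/X ord0 w]_(i < n.+1) X i w.

Lemma measurable_max_RV : measurable_fun setT max_RV.
Proof.
rewrite /max_RV; elim: (index_enum _) => [|i s IH].
  by under eq_fun do rewrite big_nil; exact: measurable_funPT.
under eq_fun do rewrite big_cons.
by apply: measurable_maxr IH; exact: measurable_funPT.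
Qed.

HB.instance Definition _ := isMeasurableFun.Build _ _ _ _ max_RV
  measurable_max_RV.

Definition largest_order_stat : {RV P >-> R} := max_RV.

End max_RV.

(* [sup] is real-valued, with the junk value 0 on empty or unbounded sets; for
   [h] a cdf and 0 < u < 1 the set below is nonempty and bounded above. *)
Definition right_inverse (R : realType) (h : R -> \bar R) (u : R) : R :=
  sup [set x : R | (h x <= u%:E)%E].

Definition le_disp d1 (T1 : measurableType d1) d2 (T2 : measurableType d2)
    (R : realType) (P : probability T1 R) (Q : probability T2 R)
    (X : {RV P >-> R}) (Y : {RV Q >-> R}) : Prop :=
  forall u v : R, 0 < u -> u <= v -> v < 1 ->
    right_inverse (cdf X) v - right_inverse (cdf X) u
    <= right_inverse (cdf Y) v - right_inverse (cdf Y) u.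

(* Main.v *)
Require Import Defs.
From HB Require Import structures.
From mathcomp Require Import all_boot all_order all_algebra.
From mathcomp Require Import all_classical all_reals all_analysis.
From mathcomp Require Import measurable_realfun ring lra.

Import Order.TTheory GRing.Theory Num.Theory.
Import numFieldNormedType.Exports.

Local Open Scope classical_set_scope.
Local Open Scope ring_scope.

(** Both largest order statistics are again ENH. By independence the
    distribution function of [X_{n:n}] is the product of the [G^beta_i], hence
    [G^B], where [G] is the Nadarajah-Haghighi distribution function and [B]
    the sum of the [beta_i]; likewise [G^B'] for the other sample
    ([is_ENH_largest_order_stat]).

    The quantile of [G^B] at [u] is therefore [G^{-1} (u^(1/B))]. With
    [L = ln u < 0] it is an affine function of [w (L / B)], where
    [w s = (1 - ln (1 - e^s))^(1/alpha)] ([right_inverse_cdf_ENH]), so the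
    dispersive order asserts that [w (a L) - w (b L)] is nondecreasing in
    [L < 0], for [a = 1/B <= b = 1/B']. The derivative of this difference is
    [((- a L) w' (a L) - (- b L) w' (b L)) / (- L)], and [b L <= a L]; it thus
    suffices that [- s w' s] be nondecreasing on the negative half-line
    ([elasticity_NH_log_quantile_ndecr]). Now
    [- s w' s = alpha^-1 (1 - ln (1 - e^s))^(1/alpha - 1)
                * (- s) / (e^(- s) - 1)]
    is a product of two nonnegative nondecreasing factors: the first because
    [alpha < 1] makes its exponent positive, the second because
    [(e^t - 1) / t] is nondecreasing in [t > 0] ([expRB1_div_ndecr]). *)

(** * The quantile function on a logarithmic scale *)

(** With [c = alpha^-1] this is [1 + lambda * x], where [x] is the quantile of
    level [e^s] of the Nadarajah-Haghighi law. The logarithm of the level is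
    taken as the variable because changing the exponent of an ENH law then only
    rescales [s]. *)
Definition NH_log_quantile {R : realType} (c s : R) : R :=
  (1 - ln (1 - expR s)) `^ c.

Definition dNH_log_quantile {R : realType} (c s : R) : R :=
  c * (1 - ln (1 - expR s)) `^ (c - 1) * (expR s / (1 - expR s)).

Lemma NH_log_quantile_base_ge1 {R : realType} {s : R} :
  s < 0 -> 1 <= 1 - ln (1 - expR s).
Proof.
by move=> s0; rewrite lerBrDr gerDl ln_le0// lerBlDr lerDl expR_ge0.
Qed.

Lemma is_derive_NH_log_quantile {R : realType} (c : R) {s : R} : s < 0 ->
  is_derive s 1 (NH_log_quantile c) (dNH_log_quantile c s).
Proof.
move=> s0.
have e0 : 0 < 1 - expR s by rewrite subr_gt0 expR_lt1.
have b0 : 0 < 1 - ln (1 - expR s).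
  exact: lt_le_trans ltr01 (NH_log_quantile_base_ge1 s0).
have dln := @is_derive1_comp R (@ln R) (fun t => 1 - expR t) s _ _
  (is_derive1_ln e0) (is_deriveB (is_derive_cst _ _ _) (is_derive_expR s)).
have dpow := @is_derive1_comp R (fun y => y `^ c)
  (fun t => 1 - ln (1 - expR t)) s _ _
  (is_derive1_powR c b0) (is_deriveB (is_derive_cst _ _ _) dln).
apply: (is_derive_eq dpow).
rewrite /dNH_log_quantile /=.
by field; rewrite gt_eqF.
Qed.

(** Monotonicity of the slope [(e^x - 1) / x] of a chord of the exponential,
    with denominators cleared. The difference of the two sides is a sum of two
    nonnegative terms, obtained from the tangent bound [1 + t <= e^t] at
    [t = y - x] and at [t = - x]. *)
Lemma expRB1_div_ndecr {R : realType} (x y : R) : 0 <= x -> x <= y ->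
  y * (expR x - 1) <= x * (expR y - 1).
Proof.
move=> x0 xy.
have eyx : expR y = expR x * expR (y - x) by rewrite -expRD addrC subrK.
have eyx1 : 1 + (y - x) <= expR (y - x) := expR_ge1Dx _.
have exN1 : 1 - x <= expR (- x) by have := expR_ge1Dx (- x).
have ex0 : 0 < expR x := expR_gt0 _.
have : (1 - x) * expR x <= 1.
  by rewrite -ler_pdivlMr// div1r -expRN.
rewrite eyx; set E := expR x in ex0 *; set F := expR (y - x) in eyx1 *.
move=> E1.
have h1 : 0 <= x * E * (F - 1 - (y - x)).
  by apply: mulr_ge0; [apply: mulr_ge0 => //; exact: ltW|lra].
have h2 : 0 <= (y - x) * (1 - (1 - x) * E) by apply: mulr_ge0; lra.
rewrite -subr_ge0; apply: le_trans (addr_ge0 h1 h2) _.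
by rewrite le_eqVlt; apply/orP; left; apply/eqP; ring.
Qed.

(** In [- s w' s] the odds [e^s / (1 - e^s)] contained in [w'] equal
    [1 / (e^(- s) - 1)], so they combine with [- s] into the reciprocal of a
    chord slope of the exponential at [- s]; the remaining factor is
    nondecreasing since [1 <= c]. *)
Lemma elasticity_NH_log_quantile_ndecr {R : realType} (c s t : R) : 1 <= c ->
  s <= t -> t < 0 ->
  - s * dNH_log_quantile c s <= - t * dNH_log_quantile c t.
Proof.
move=> c1 st t0.
have s0 : s < 0 by exact: le_lt_trans st t0.
have c0 : 0 <= c by lra.
have odds (r : R) : r < 0 -> expR r / (1 - expR r) = (expR (- r) - 1)^-1.
  move=> r0; rewrite expRN.
  have ? : expR r != 0 by rewrite gt_eqF ?expR_gt0.
  have ? : 1 - expR r != 0 by rewrite gt_eqF// subr_gt0 expR_lt1.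
  by field; rewrite mulN1r; apply/andP.
have e1 (r : R) : r < 0 -> 0 < expR (- r) - 1.
  by move=> r0; rewrite subr_gt0 expR_gt1 oppr_gt0.
have splitE (r : R) : - r * dNH_log_quantile c r =
    c * (1 - ln (1 - expR r)) `^ (c - 1) * (- r * (expR r / (1 - expR r))).
  by rewrite /dNH_log_quantile mulrCA.
rewrite !splitE; apply: ler_pM.
- by rewrite mulr_ge0// powR_ge0.
- by rewrite odds// mulr_ge0// ?oppr_ge0 ?invr_ge0 ltW// e1.
- apply: (ler_wpM2l c0).
  apply: ge0_ler_powR; [by rewrite subr_ge0|rewrite nnegrE|rewrite nnegrE|].
  + exact: le_trans ler01 (NH_log_quantile_base_ge1 s0).
  + exact: le_trans ler01 (NH_log_quantile_base_ge1 t0).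
  + by rewrite lerD2l lerN2 ler_ln ?posrE ?subr_gt0 ?expR_lt1// lerD2l lerN2
      ler_expR.
- rewrite !odds// ler_pdivrMr ?e1// mulrAC ler_pdivlMr ?e1//.
  by apply: expRB1_div_ndecr; [rewrite oppr_ge0 ltW|rewrite lerN2].
Qed.

(** The dispersive inequality for two powers of one distribution function, in
    the variable [ln u]: the mean value theorem applied to
    [w (a z) - w (b z)], whose derivative is, up to the factor [- z], a
    difference of two values of [- s w' s]. *)
Lemma NH_log_quantile_spread {R : realType} (c a b x y : R) :
  1 <= c -> 0 < a -> a <= b -> x <= y -> y < 0 ->
  NH_log_quantile c (b * y) - NH_log_quantile c (b * x) <=
  NH_log_quantile c (a * y) - NH_log_quantile c (a * x).
Proof.
move=> c1 a0 ab xy y0.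
have b0 : 0 < b by exact: lt_le_trans a0 ab.
pose f (z : R) := NH_log_quantile c (a * z) - NH_log_quantile c (b * z).
pose df (z : R) :=
  dNH_log_quantile c (a * z) * a - dNH_log_quantile c (b * z) * b.
have dscale (k z : R) : 0 < k -> z < 0 ->
    is_derive z 1 (fun t : R => NH_log_quantile c (k * t))
      (dNH_log_quantile c (k * z) * k).
  move=> k0 z0.
  have kz0 : k * z < 0 by rewrite pmulr_rlt0.
  have dk : is_derive z 1 ( *%R k) k.
    by apply: is_derive_eq; rewrite /GRing.scale/= mulr1.
  exact: (is_derive1_comp (is_derive_NH_log_quantile c kz0) dk).
have fdf (z : R) : z < 0 -> is_derive z 1 f (df z).
  by move=> z0; exact: is_deriveB (dscale _ _ a0 z0) (dscale _ _ b0 z0).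
have der (z : R) : z \in `]x, y[ -> is_derive z 1 f (df z).
  by rewrite in_itv/= => /andP[_ zy]; apply: fdf; exact: lt_trans zy y0.
have cont : {within `[x, y], continuous f}.
  apply: derivable_within_continuous => z; rewrite in_itv/= => /andP[_ zy].
  by have [] := fdf z (le_lt_trans zy y0).
have [z] := MVT_segment xy der cont.
rewrite in_itv/= => /andP[_ zy] fE.
have z0 := le_lt_trans zy y0.
have dfz0 : 0 <= df z.
  rewrite -(pmulr_rge0 _ (x := - z)) ?oppr_gt0// mulrBr subr_ge0.
  have := @elasticity_NH_log_quantile_ndecr R c (b * z) (a * z) c1.
  rewrite ler_nM2r// pmulr_rlt0// => /(_ ab z0).
  have scaleE (k D : R) : - (k * z) * D = - z * (D * k) by ring.
  by rewrite !scaleE.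
have : 0 <= f y - f x by rewrite fE mulr_ge0// subr_ge0.
rewrite /f.
move: (NH_log_quantile c (a * y)) (NH_log_quantile c (a * x))
  (NH_log_quantile c (b * y)) (NH_log_quantile c (b * x)) => p q r t.
by clear; lra.
Qed.

(** * Quantiles and the dispersive order *)

Lemma NH_cdf_gt0 {R : realType} {alpha lambda x : R} :
  0 < alpha -> 0 < lambda -> 0 < x ->
  0 < 1 - expR (1 - (1 + lambda * x) `^ alpha).
Proof.
move=> a0 l0 x0; rewrite subr_gt0 expR_lt1 subr_lt0.
have lx1 : 1 < 1 + lambda * x by rewrite ltrDl mulr_gt0.
rewrite /powR gt_eqF ?(lt_trans ltr01)// -[ltLHS]expR0 ltr_expR.
by rewrite mulr_gt0// ln_gt0.
Qed.

(** The sublevel set of the distribution function at [u] is a closed half-line: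
    for positive [x] the equation defining the quantile is inverted one
    monotone function at a time, and the nonpositive [x], where the distribution
    function vanishes, all lie below the quantile, which is nonnegative. *)
Lemma right_inverse_cdf_ENH {R : realType} {d} {T : measurableType d}
    {P : probability T R} {Y : {RV P >-> R}} {alpha lambda beta u : R} :
  0 < alpha -> 0 < lambda -> 0 < beta -> is_ENH Y alpha lambda beta ->
  0 < u -> u < 1 ->
  Defs.right_inverse (cdf Y) u =
    (NH_log_quantile alpha^-1 (beta^-1 * ln u) - 1) / lambda.
Proof.
move=> a0 l0 b0 YE u0 u1; set s := beta^-1 * ln u.
have s0 : s < 0 by rewrite pmulr_rlt0 ?invr_gt0// ln_lt0// u0 u1.
have y1 := NH_log_quantile_base_ge1 s0.
set y := 1 - ln (1 - expR s) in y1 *.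
have y0 : 0 < y by exact: lt_le_trans ltr01 y1.
rewrite /Defs.right_inverse -[RHS](@sup_itv _ -oo%O false); last by [].
congr sup; apply/funext => x /=; apply/propext; rewrite in_itv/= YE lee_fin.
rewrite /NH_log_quantile -/y ler_pdivlMr// lerBrDl [x * _]mulrC.
suff -> : ((if 0 < x then (1 - expR (1 - (1 + lambda * x) `^ alpha)) `^ beta
            else 0) <= u) = (1 + lambda * x <= y `^ alpha^-1) by [].
case: ltP => [x0|x0]; last first.
  rewrite ltW//; apply/esym/(@le_trans _ _ 1).
    by rewrite gerDl pmulr_rle0.
  rewrite /powR gt_eqF// -[leLHS]expR0 ler_expR.
  by rewrite mulr_ge0 ?ln_ge0// invr_ge0 ltW.
have lx0 : 0 < lambda * x by exact: mulr_gt0.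
have lx1 : 0 < 1 + lambda * x by rewrite addr_gt0.
have G0 := NH_cdf_gt0 a0 l0 x0.
(* Successively undo the power [beta], the outer exponential, and the power
   [alpha]. *)
rewrite {1}/powR gt_eqF// -[leRHS](@lnK _ u) ?posrE// ler_expR -ler_pdivlMl// -/s.
rewrite -[s]expRK ler_ln ?posrE ?expR_gt0// lerBlDl -lerBlDr.
rewrite -{1}(@lnK _ (1 - expR s)) ?posrE ?subr_gt0 ?expR_lt1//.
rewrite ler_expR lerBrDr -lerBrDl -/y /powR !gt_eqF//.
rewrite -{1}(@lnK _ y) ?posrE// ler_expR -ler_pdivlMl//.
by rewrite -{2}(@lnK _ (1 + lambda * x)) ?posrE// ler_expR.
Qed.

(** The distribution functions of [Y'] and [Y] are powers of the same one, so
    their quantiles at [u] are read off from [w] at the multiples [ln u / beta']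
    and [ln u / beta] of [ln u]. *)
Lemma le_disp_ENH {R : realType}
    {d} {T : measurableType d} {P : probability T R}
    {d'} {T' : measurableType d'} {P' : probability T' R}
    {Y : {RV P >-> R}} {Y' : {RV P' >-> R}} {alpha lambda beta beta' : R} :
  0 < alpha -> alpha <= 1 -> 0 < lambda -> 0 < beta' ->
  is_ENH Y' alpha lambda beta' -> is_ENH Y alpha lambda beta ->
  beta' <= beta -> le_disp Y' Y.
Proof.
move=> a0 a1 l0 b'0 Y'E YE le_b u v u0 uv v1.
have b0 := lt_le_trans b'0 le_b.
have v0 := lt_le_trans u0 uv; have u1 := le_lt_trans uv v1.
rewrite (right_inverse_cdf_ENH a0 l0 b'0 Y'E u0 u1).
rewrite (right_inverse_cdf_ENH a0 l0 b'0 Y'E v0 v1).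
rewrite (right_inverse_cdf_ENH a0 l0 b0 YE u0 u1).
rewrite (right_inverse_cdf_ENH a0 l0 b0 YE v0 v1).
have affineE (p q : R) :
    (p - 1) / lambda - (q - 1) / lambda = (p - q) / lambda.
  by rewrite -mulrBl opprB addrA subrK.
have l1 : 0 < lambda^-1 by rewrite invr_gt0.
rewrite [leLHS]affineE [leRHS]affineE (ler_pM2r l1).
apply: NH_log_quantile_spread.
- by rewrite invf_ge1.
- by rewrite invr_gt0.
- by rewrite lef_pV2 ?posrE.
- by rewrite ler_ln ?posrE.
- by rewrite ln_lt0// v0 v1.
Qed.

(** * Distribution of the maximum *)

Lemma cdf_largest_order_stat {R : realType} {d} {T : measurableType d}
    {P : probability T R} {n} (X : 'I_n.+1 -> {RV P >-> R}) (x : R) :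
  mutually_independent X ->
  cdf (largest_order_stat X) x = (\prod_(i < n.+1) cdf (X i) x)%E.
Proof.
move=> indepX.
have := indepX [set: 'I_n.+1]%SET (fun=> `]-oo, x]%classic)
  (fun=> measurable_itv _).
rewrite (eq_bigl predT) => [<-|i]; last by rewrite finset.in_setT.
rewrite /cdf/= /distribution/= /pushforward; congr (P _).
apply/seteqP; split => w /=; rewrite in_itv/= /max_RV.
  by move=> /bigmax_leP[_ le_x] i _ /=; rewrite in_itv/= le_x.
move=> le_x; apply/bigmax_leP.
have X_le i : X i w <= x.
  by have := le_x i; rewrite /= in_itv/=; apply; rewrite finset.in_setT.
by split=> [|i _].
Qed.

Lemma prod_powR {R : realType} {I : finType} (a : R) (b : I -> R) : 0 < a ->
  \prod_i a `^ b i = a `^ (\sum_i b i).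
Proof.
move=> a0; elim/big_rec2: _ => [|i p s _ ->]; first by rewrite powRr0.
by rewrite powRD// (gt_eqF a0) implybT.
Qed.

(** The ENH family with fixed [alpha] and [lambda] is closed under maxima of
    independent variables, the exponents adding up, since its distribution
    functions are the powers of a single one. *)
Lemma is_ENH_largest_order_stat {R : realType} {d} {T : measurableType d}
    {P : probability T R} {n} {X : 'I_n.+1 -> {RV P >-> R}}
    {alpha lambda : R} {beta : 'I_n.+1 -> R} :
  0 < alpha -> 0 < lambda -> mutually_independent X ->
  (forall i, is_ENH (X i) alpha lambda (beta i)) ->
  is_ENH (largest_order_stat X) alpha lambda (\sum_(i < n.+1) beta i).
Proof.
move=> a0 l0 indepX XE x; rewrite cdf_largest_order_stat//.
under eq_bigr do rewrite XE.
rewrite prodEFin; congr EFin.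
case: ifPn => [x0|_]; last by rewrite big_ord_recl mul0r.
by apply: prod_powR; exact: NH_cdf_gt0.
Qed.

Theorem theorem3p7 (R : realType) (n : nat)
  (d : measure_display) (T : measurableType d) (P : probability T R)
  (d' : measure_display) (T' : measurableType d') (P' : probability T' R)
  (alpha lambda : R) (beta beta' : 'I_n.+1 -> R)
  (X : 'I_n.+1 -> {RV P >-> R}) (X' : 'I_n.+1 -> {RV P' >-> R})
  (alpha_gt0 : 0 < alpha) (alpha_lt1 : alpha < 1) (lambda_gt0 : 0 < lambda)
  (beta_gt0 : forall i, 0 < beta i) (beta'_gt0 : forall i, 0 < beta' i)
  (indepX : mutually_independent X) (indepX' : mutually_independent X')
  (ENHX : forall i, is_ENH (X i) alpha lambda (beta i))
  (ENHX' : forall i, is_ENH (X' i) alpha lambda (beta' i))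
  (le_sum : \sum_(i < n.+1) beta' i <= \sum_(i < n.+1) beta i)
  (sum_lt1 : \sum_(i < n.+1) beta i < 1) :
  le_disp (largest_order_stat X') (largest_order_stat X).
Proof.
have sum_gt0 (b : 'I_n.+1 -> R) : (forall i, 0 < b i) ->
    0 < \sum_(i < n.+1) b i.
  move=> b0; rewrite big_ord_recl ltr_wpDr// sumr_ge0// => i _.
  exact: ltW.
apply: le_disp_ENH le_sum; [exact: alpha_gt0|exact: ltW alpha_lt1|
  exact: lambda_gt0|exact: sum_gt0| |].
- exact: is_ENH_largest_order_stat alpha_gt0 lambda_gt0 indepX' ENHX'.
- exact: is_ENH_largest_order_stat alpha_gt0 lambda_gt0 indepX ENHX.
Qed.
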